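(* For every prime $p>2$, $$\sum_{n=0}^{p-1}\frac{(\frac12)_n(\frac12)_{2n}}{n!^3}(20n+3)\frac{(-1)^n}{2^{4n}}\equiv3(-1)^{(p-1)/2}\,p\pmod{p^3};$$ equivalently (using $(\frac12)_{2n}=4^n(\frac14)_n(\frac34)_n$), $$\sum_{n=0}^{p-1}\frac{(\frac12)_n(\frac14)_n(\frac34)_n}{n!^3}(20n+3)\frac{(-1)^n}{2^{2n}}\equiv3(-1)^{(p-1)/2}\,p\pmod{p^3}.$$
   Context: $(a)_n=a(a+1)\cdots(a+n-1)=\Gamma(a+n)/\Gamma(a)$ denotes the Pochhammer symbol, with $(a)_0=1$. The sums are rational numbers with denominators coprime to $p$; congruences are understood in the ring of rationals with denominators coprime to $p$. Note $(-1)^{(p-1)/2}$ equals the Legendre symbol $\bigl(\frac{-1}{p}\bigr)$. *)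

(* Defs.v *)
From mathcomp Require Import all_boot all_order all_algebra.

Set Implicit Arguments.
Unset Strict Implicit.
Unset Printing Implicit Defensive.

Import Order.TTheory GRing.Theory Num.Theory.
Local Open Scope ring_scope.

Definition poch (a : rat) (n : nat) : rat := \prod_(0 <= i < n) (a + i%:R).

(* [denq x] is a positive [int]; [`|denq x|%N] is the same number in [nat]. *)
Definition pintegral (p : nat) (x : rat) : Prop := coprime p `|denq x|%N.

(* Congruence modulo the ideal generated by m in the ring of rationals with
   denominator coprime to p. Membership of both sides in that ring is part of
   the claim, and the cofactor z must lie in it too. *)
Definition pcongr (p m : nat) (x y : rat) : Prop :=
  [/\ pintegral p x, pintegral p y
    & exists2 z : rat, pintegral p z & x - y = m%:R * z].

(* Main.v *)
(* The summand is F(n,0) for a Wilf-Zeilberger pair (F,G) with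
   F(n,k) - F(n,k+1) = G(n+1,k) - G(n,k) and G(0,k) = 0, so for K = (p-1)/2 the
   sum over n < p is the sum of F(n,K) over n < p plus the sum of G(p,k) over
   k < K. Counting the factors p/2 and 3p/2 in the Pochhammer symbols shows
   that all these terms vanish mod p^3 except F(K,K), as F(n,K) = 0 for n < K.
   The term F(K,K) is 3p Q / (16^K K!^2), where Q is the product of p/2 + i over
   0 < i < p. Pairing i with p - i gives Q = (p-1)! mod p^2, which is
   (-16)^K K!^2 mod p^2 by Morley's congruence for binomial(p-1, K). *)
Require Import Defs.
From HB Require Import structures.
From mathcomp Require Import all_boot all_order all_algebra.
From mathcomp Require Import ring zify.

Set Implicit Arguments.
Unset Strict Implicit.
Unset Printing Implicit Defensive.

Import Order.TTheory GRing.Theory Num.Theory.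
Local Open Scope ring_scope.

(** * The ring of p-integral rationals and its congruences *)

Lemma pintegral_frac (p d : nat) (a : int) :
  coprime p d -> pintegral p (a%:~R / d%:R).
Proof.
have [->|d0] := eqVneq d 0%N.
  by rewrite mulr0n invr0 mulr0 /pintegral coprimen1.
move=> cpd; apply: coprime_dvdr cpd.
have d0' : (d%:R : rat) != 0 by rewrite pnatr_eq0.
set x := a%:~R / _.
have dx0 : ((denq x)%:~R : rat) != 0 by rewrite intr_eq0 denq_neq0.
have e : numq x * d%:Z = a * denq x.
  apply/eqP; rewrite -(eqr_int rat) !rmorphM /=; apply/eqP.
  by rewrite (numqE x) /x; field.
(* The reduced denominator divides [numq x * d] and is coprime to [numq x], so it divides [d]. *)
have := coprime_num_den x.
rewrite coprime_sym => /Gauss_dvdr <-.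
have := congr1 absz e; rewrite !abszM /= => ->.
exact: dvdn_mull.
Qed.

Section PIntegral.

Variable p : nat.

(** The property [pintegral] as a collective predicate, so that a subring structure can be attached
    and the [rpred] lemmas apply. *)
Definition pint : {pred rat} := fun x => coprime p `|denq x|%N.

Fact pint_subring_closed : subring_closed pint.
Proof.
split=> [|x y|x y]; first exact: coprimen1.
- move=> cx cy.
  have -> : x - y = (numq x * denq y - numq y * denq x)%:~R
      / (`|denq x| * `|denq y|)%:R.
    rewrite natrM !pmulrn !absz_denq rmorphB !rmorphM /=.
    rewrite -{1}(divq_num_den x) -{1}(divq_num_den y).
    by field; rewrite !intr_eq0 !denq_neq0.
  by apply: pintegral_frac; rewrite coprimeMr; apply/andP.
- move=> cx cy.
  have -> : x * y = (numq x * numq y)%:~R / (`|denq x| * `|denq y|)%:R.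
    rewrite natrM !pmulrn !absz_denq !rmorphM /=.
    rewrite -{1}(divq_num_den x) -{1}(divq_num_den y).
    by field; rewrite !intr_eq0 !denq_neq0.
  by apply: pintegral_frac; rewrite coprimeMr; apply/andP.
Qed.

HB.instance Definition _ :=
  GRing.isSubringClosed.Build rat pint pint_subring_closed.

Lemma pintP x : x \in pint -> pintegral p x.
Proof. by []. Qed.

Lemma pint_natV (d : nat) : coprime p d -> (d%:R : rat)^-1 \in pint.
Proof. by move/(@pintegral_frac p d 1); rewrite mul1r. Qed.

Lemma pcongr_refl m x : x \in pint -> pcongr p m x x.
Proof.
by move=> px; split=> //; exists 0; rewrite ?subrr ?mulr0 //;
  apply/pintP/rpred0.
Qed.

Lemma pcongr_trans m y x z :
  pcongr p m x y -> pcongr p m y z -> pcongr p m x z.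
Proof.
case=> px py [u pu eu] [_ pz [v pv ev]]; split=> //.
exists (u + v); first exact/pintP/rpredD.
by rewrite mulrDr -eu -ev addrA subrK.
Qed.

Lemma pcongrD m x y u v :
  pcongr p m x y -> pcongr p m u v -> pcongr p m (x + u) (y + v).
Proof.
case=> px py [z pz e] [pu pv [w pw f]]; split; try exact/pintP/rpredD.
exists (z + w); first exact/pintP/rpredD.
by rewrite mulrDr -e -f; ring.
Qed.

Lemma pcongrM m x y u v :
  pcongr p m x y -> pcongr p m u v -> pcongr p m (x * u) (y * v).
Proof.
case=> px py [z pz e] [pu pv [w pw f]]; split; try exact/pintP/rpredM.
(* From x u - y v = (x - y) u + y (u - v). *)
exists (z * u + y * w); first by apply/pintP/rpredD; exact: rpredM.
rewrite mulrDr mulrA -e [m%:R * (y * w)]mulrCA -f; ring.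
Qed.

Lemma pcongr_prod m n (f g : nat -> rat) :
  (forall i, (i < n)%N -> pcongr p m (f i) (g i)) ->
  pcongr p m (\prod_(0 <= i < n) f i) (\prod_(0 <= i < n) g i).
Proof.
move=> fg; rewrite !big_mkord.
elim/big_ind2: _ => [|x y u v|i _]; last exact: fg.
  exact/pcongr_refl/rpred1.
exact: pcongrM.
Qed.

Lemma pcongr0_sum m n1 n2 (f : nat -> rat) :
  (forall i, (n1 <= i < n2)%N -> pcongr p m (f i) 0) ->
  pcongr p m (\sum_(n1 <= i < n2) f i) 0.
Proof.
move=> f0; rewrite big_nat_cond.
apply: (big_ind (fun x => pcongr p m x 0)) => [|x y x0 y0|i].
- exact/pcongr_refl/rpred0.
- by rewrite -[0]addr0; exact: pcongrD.
- by rewrite andbT; exact: f0.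
Qed.

(** Lets powers of p be collected factor by factor. *)
Lemma pcongr0M m n x y :
  pcongr p m x 0 -> pcongr p n y 0 -> pcongr p (m * n) (x * y) 0.
Proof.
case=> px p0 [z pz e] [py _ [w pw f]]; split=> //; first exact/pintP/rpredM.
exists (z * w); first exact/pintP/rpredM.
rewrite !subr0 in e f *; rewrite natrM e f; ring.
Qed.

Lemma pcongr0Ml m x y : x \in pint -> pcongr p m y 0 -> pcongr p m (x * y) 0.
Proof.
by move=> px; rewrite -{2}(mulr0 x); apply: pcongrM; exact: pcongr_refl.
Qed.

Lemma pcongr0_nat m : pcongr p m m%:R 0.
Proof.
split; [exact/pintP/rpred_nat|exact/pintP/rpred0|].
exists 1; first exact/pintP/rpred1.
by rewrite subr0 mulr1.
Qed.

Lemma pcongr_scale m n x y :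
  pcongr p n x y -> pcongr p (m * n) (m%:R * x) (m%:R * y).
Proof.
case=> px py [z pz e]; split; try by apply/pintP/rpredM => //; exact: rpred_nat.
by exists z => //; rewrite natrM -mulrA -e mulrBr.
Qed.

End PIntegral.

(** * Pochhammer symbols and reciprocal factorials *)

Lemma pochS a n : poch a n.+1 = poch a n * (a + n%:R).
Proof. by rewrite /poch big_nat_recr. Qed.

Lemma pochD a m n : poch a (m + n) = poch a m * poch (a + m%:R) n.
Proof.
elim: n => [|n IHn]; first by rewrite addn0 /poch [X in _ * X]big_geq ?mulr1.
by rewrite addnS !pochS IHn natrD; ring.
Qed.

Lemma poch_gt0 a n : 0 < a -> 0 < poch a n.
Proof. by move=> a0; apply: prodr_gt0 => i _; rewrite ltr_wpDr. Qed.

(** The factors 1/2 + 2n and 1/2 + 2n + 1 are 2 (1/4 + n) and 2 (3/4 + n). *)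
Lemma poch_half_double n :
  poch (1 / 2) (2 * n) = 4 ^+ n * poch (1 / 4) n * poch (3 / 4) n.
Proof.
elim: n => [|n IHn]; first by rewrite /poch !big_geq ?mulr1.
rewrite mulnS !addSn add0n !pochS IHn exprS -natr1 natrM; by field.
Qed.

(* [rfact n k] is 1 / Gamma(n - k + 1), extended by 0 to [n < k]. *)
Definition rfact (n k : nat) : rat :=
  if (k <= n)%N then (((n - k)`!)%:R)^-1 else 0.

Lemma fact_neq0 n : ((n`!)%:R : rat) != 0.
Proof. by rewrite pnatr_eq0 -lt0n fact_gt0. Qed.

Lemma rfactSS n k : rfact n.+1 k.+1 = rfact n k.
Proof. by []. Qed.

(** This is 1/Gamma(z) = z/Gamma(z+1) at z = n - k. It also holds at the poles, so the WZ identity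
    needs no case split on k <= n. *)
Lemma rfactS n k : rfact n k.+1 = (n%:R - k%:R) * rfact n k.
Proof.
rewrite /rfact; case: ltngtP => [kn|kn|->]; rewrite ?mulr0 ?subrr ?mul0r //.
rewrite -natrB; last exact: ltnW.
have -> : (n - k = (n - k.+1).+1)%N by lia.
rewrite factS natrM invfM mulVKf // pnatr_eq0; lia.
Qed.

(** * The Wilf-Zeilberger pair and its telescoping *)

Definition WZF (n k : nat) : rat :=
  (-1) ^+ (n + k) * (20 * n%:R - 2 * k%:R + 3) * poch (1 / 2) n
  * poch (1 / 2) (2 * n + k) * rfact n k
  / (16 ^+ n * (n`!)%:R ^+ 2 * poch (1 / 2) k ^+ 2).

(** Equals R F with the rational certificate R = -128 n^2 (n - k) / ((20n - 2k + 3) (2k + 1)^2). *)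
Definition WZG (n k : nat) : rat :=
  32 * n%:R ^+ 2 * (-1) ^+ (n + k).+1 * poch (1 / 2) n
  * poch (1 / 2) (2 * n + k) * rfact n k.+1
  / (16 ^+ n * (n`!)%:R ^+ 2 * poch (1 / 2) k.+1 ^+ 2).

Lemma WZ_pair n k : WZF n k - WZF n k.+1 = WZG n.+1 k - WZG n k.
Proof.
rewrite /WZF /WZG rfactSS !rfactS factS mulnS !addSn !add0n !addnS.
rewrite !pochS !exprS !natrM -!natr1 natrD natrM.
have p0 : poch (1 / 2) k != 0 by rewrite gt_eqF ?poch_gt0.
have f0 := fact_neq0 n.
have n0 : (n%:R + 1 : rat) != 0 by rewrite natr1 pnatr_eq0.
have e0 : (16 ^+ n : rat) != 0 by rewrite expf_neq0.
have k0 : (1 + k%:R * 2 : rat) != 0 by rewrite -natrM addrC natr1 pnatr_eq0.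
(* All shifted quantities are now rational multiples of these common ones; an identity of rational
   functions remains. *)
move: (poch _ n) (poch _ (2 * n + k)) (poch _ k) (_ ^+ (n + k)) (rfact _ _)
  (16 ^+ n) p0 e0 => a b c s r e p0 e0.
by field; rewrite k0 p0 f0 e0 n0.
Qed.

Lemma WZ_sumB n k :
  \sum_(0 <= i < n) WZF i k = \sum_(0 <= i < n) WZF i k.+1 + WZG n k.
Proof.
apply/eqP; rewrite -subr_eq0 opprD addrA -sumrB.
rewrite (eq_bigr _ (fun i _ => WZ_pair i k)) telescope_sumr //.
(* The factor n^2 kills the boundary term at n = 0. *)
by rewrite {2}/WZG expr0n /= !(mulr0, mul0r) subr0 subrr.
Qed.

Lemma WZ_sum n k :
  \sum_(0 <= i < n) WZF i 0
  = \sum_(0 <= i < n) WZF i k + \sum_(0 <= j < k) WZG n j.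
Proof.
elim: k => [|k ->]; first by rewrite [X in _ + X]big_geq ?addr0.
by rewrite WZ_sumB big_nat_recr //= -addrA [WZG _ _ + _]addrC.
Qed.

(** * Folded products and factorials *)

Lemma prod_nat_fold (f : nat -> rat) n :
  \prod_(0 <= i < 2 * n) f i
  = \prod_(0 <= i < n) (f i * f ((2 * n).-1 - i)%N).
Proof.
elim: n f => [|n IHn] f; first by rewrite !big_geq.
(* The first and the last factor are peeled off together. *)
rewrite mulnS !addSn add0n [RHS]big_nat_recl // [LHS]big_nat_recl //.
rewrite big_nat_recr //= IHn subn0 -mulrA [_ * f (2 * n).+1]mulrC.
congr (_ * (_ * _)).
apply: eq_big_nat => i /andP[_ ni]; congr (f _ * f _); lia.
Qed.

Lemma natr_fact n : (n`!)%:R = \prod_(0 <= i < n) (i.+1)%:R :> rat.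
Proof.
elim: n => [|n IHn]; first by rewrite big_geq.
by rewrite factS mulnC natrM IHn big_nat_recr.
Qed.

Lemma natr_fact_double n :
  ((2 * n)`!)%:R = 2 ^+ n * (n`!)%:R * \prod_(0 <= i < n) (2 * i + 1)%:R :> rat.
Proof.
elim: n => [|n IHn]; first by rewrite big_geq.
rewrite mulnS !addSn add0n !factS !natrM IHn big_nat_recr //= exprS.
rewrite -[(2 * n).+2%:R]natr1 -!natr1 natrD !natrM; ring.
Qed.

(** * Divisibility of the WZ terms by powers of p = 2K + 1 *)

Section OddPrime.

Variables p K : nat.
Hypothesis p_prime : prime p.
Hypothesis pE : p = (2 * K).+1.

Let coprime_p2 : coprime p 2.
Proof. by rewrite coprime_sym coprime2n pE /= mul2n odd_double. Qed.

Let pint_half : 1 / 2 \in pint p.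
Proof. by rewrite mul1r; exact: pint_natV. Qed.

Let pint_16V n : (16 ^+ n)^-1 \in pint p.
Proof.
have -> : (16 ^+ n : rat) = ((2 ^ 4) ^ n)%:R by rewrite natrX.
by apply: pint_natV; rewrite !coprimeXr.
Qed.

Lemma pint_factV n : (n < p)%N -> ((n`!)%:R : rat)^-1 \in pint p.
Proof.
move=> np; apply: pint_natV; elim: n np => [|n IHn] np; first exact: coprimen1.
rewrite factS coprimeMr IHn ?andbT; last exact: ltnW.
by rewrite prime_coprime // gtnNdvd.
Qed.

Lemma pint_rfact n k : (n - k < p)%N -> rfact n k \in pint p.
Proof.
rewrite /rfact; case: ifP => _ nkp; [exact: pint_factV|exact: rpred0].
Qed.

Lemma pint_poch a n : a \in pint p -> poch a n \in pint p.
Proof.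
by move=> pa; apply: rpred_prod => i _; apply: rpredD => //; exact: rpred_nat.
Qed.

(** Each factor is (2i + 1)/2 with 2i + 1 < p. *)
Lemma pint_poch_halfV k : (k <= K)%N -> (poch (1 / 2) k)^-1 \in pint p.
Proof.
elim: k => [|k IHk] kK; first by rewrite /poch big_geq // invr1 rpred1.
rewrite pochS invfM rpredM ?IHk ?(ltnW kK) //.
have -> : (1 / 2 + k%:R : rat)^-1 = 2 * ((2 * k + 1)%:R)^-1.
  have k0 : (1 + k%:R * 2 : rat) != 0 by rewrite -natrM addrC natr1 pnatr_eq0.
  by rewrite natrD natrM; field; rewrite addrC mulrC k0.
rewrite rpredM ?rpred_nat // pint_natV // prime_coprime // gtnNdvd //; lia.
Qed.

Lemma pcongr0_poch a j n : a \in pint p -> pcongr p p (a + j%:R) 0 ->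
  (j < n)%N -> pcongr p p (poch a n) 0.
Proof.
move=> pa aj0 jn; rewrite -(subnKC jn) pochD pochS -mulrA.
apply: pcongr0Ml; first exact: pint_poch.
rewrite mulrC; apply: pcongr0Ml => //; apply/pint_poch/rpredD => //.
exact: rpred_nat.
Qed.

Let pcongr0_pM x : x \in pint p -> pcongr p p (x * p%:R) 0.
Proof. by move=> px; apply: pcongr0Ml => //; exact: pcongr0_nat. Qed.

Lemma pcongr0_poch_half n : (K < n)%N -> pcongr p p (poch (1 / 2) n) 0.
Proof.
apply: pcongr0_poch => //.
have -> : 1 / 2 + K%:R = 1 / 2 * p%:R :> rat.
  by rewrite pE -[(2 * K).+1%:R]natr1 natrM; field.
exact: pcongr0_pM.
Qed.

Lemma pcongr0_poch_half2 n :
  (3 * K + 1 < n)%N -> pcongr p (p ^ 2) (poch (1 / 2) n) 0.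
Proof.
move=> Kn; have Kn1 : (K.+1 <= n)%N by lia.
(* The cut after index K puts the factor p/2 (index K) in the first block and 3p/2 (index 3K + 1) in
   the second. *)
rewrite -(subnKC Kn1) pochD; apply: pcongr0M.
  exact: pcongr0_poch_half.
apply: (@pcongr0_poch _ (2 * K)); last lia.
  by apply: rpredD => //; exact: rpred_nat.
have -> : 1 / 2 + K.+1%:R + (2 * K)%:R = 3 * (1 / 2) * p%:R :> rat.
  by rewrite pE -[K.+1%:R]natr1 -[(2 * K).+1%:R]natr1 natrM; field.
by apply/pcongr0_pM/rpredM => //; exact: rpred_nat.
Qed.

(** One p comes from (1/2)_n and two from (1/2)_(2n+K), since 2n + K > 3K + 1. *)
Lemma pcongr0_WZF n : (K < n < p)%N -> pcongr p (p ^ 3) (WZF n K) 0.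
Proof.
move=> /andP[Kn np].
have -> : WZF n K = (-1) ^+ (n + K) * (20 * n%:R - 2 * K%:R + 3) * rfact n K
    * ((16 ^+ n)^-1 * (n`!)%:R^-1 ^+ 2 * (poch (1 / 2) K)^-1 ^+ 2)
    * (poch (1 / 2) n * poch (1 / 2) (2 * n + K)).
  have p0 : poch (1 / 2) K != 0 by rewrite gt_eqF ?poch_gt0.
  have e0 : (16 ^+ n : rat) != 0 by rewrite expf_neq0.
  rewrite /WZF; move: (poch _ K) (16 ^+ n) p0 e0 (fact_neq0 n) => a x a0 x0 f0.
  by field; rewrite a0 x0 f0.
apply: pcongr0Ml.
  have pr : rfact n K \in pint p by apply: pint_rfact; lia.
  have pf := pint_factV np; have pp := pint_poch_halfV (leqnn K).
  by rewrite !(rpredM, rpredX, rpredD, rpredN, rpred1, rpred_nat).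
rewrite expnS; apply: pcongr0M; first exact: pcongr0_poch_half.
by apply: pcongr0_poch_half2; lia.
Qed.

Lemma pcongr0_WZG k : (k < K)%N -> pcongr p (p ^ 3) (WZG p k) 0.
Proof.
move=> kK.
have p0 : (p%:R : rat) != 0 by rewrite pnatr_eq0; lia.
have f0 := fact_neq0 p.-1.
(* The p^2 in p!^2 cancels against the factor n^2 of [WZG] at n = p, leaving only units in the
   denominator. *)
have fE : ((p`!)%:R : rat) = p%:R * (p.-1`!)%:R.
  have pp0 := prime_gt0 p_prime.
  by rewrite -natrM -[in LHS](prednK pp0) factS prednK.
have -> : WZG p k = 32 * (-1) ^+ (p + k).+1 * rfact p k.+1
    * ((16 ^+ p)^-1 * (p.-1`!)%:R^-1 ^+ 2 * (poch (1 / 2) k.+1)^-1 ^+ 2)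
    * (poch (1 / 2) p * poch (1 / 2) (2 * p + k)).
  have p1 : poch (1 / 2) k.+1 != 0 by rewrite gt_eqF ?poch_gt0.
  have e0 : (16 ^+ p : rat) != 0 by rewrite expf_neq0.
  rewrite /WZG fE; move: (poch _ k.+1) (16 ^+ p) p1 e0 => a x a0 x0.
  by field; rewrite a0 x0 f0 p0.
apply: pcongr0Ml.
  have pr : rfact p k.+1 \in pint p by apply: pint_rfact; lia.
  have pf : ((p.-1`!)%:R)^-1 \in pint p by apply: pint_factV; lia.
  have pp := pint_poch_halfV kK.
  by rewrite !(rpredM, rpredX, rpredN, rpred1, rpred_nat).
rewrite expnS; apply: pcongr0M; first by apply: pcongr0_poch_half; lia.
by apply: pcongr0_poch_half2; lia.
Qed.

(** * Morley's congruence and the shifted product *)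

Let A : rat := (K`!)%:R.
Let D : rat := \prod_(0 <= i < K) (2 * i + 1)%:R.
Let E : rat := \prod_(0 <= i < K) (p%:R - i.+1%:R).

Let natr_foldE i : (i < K)%N ->
  ((2 * K).-1 - i).+1%:R = p%:R - i.+1%:R :> rat.
Proof. by move=> iK; rewrite -natrB; [congr (_%:R); lia|lia]. Qed.

Let factE : ((2 * K)`!)%:R = A * E.
Proof.
rewrite natr_fact prod_nat_fold big_split /= -natr_fact; congr (_ * _).
by apply: eq_big_nat => i /andP[_ /natr_foldE].
Qed.

(** As p is odd, the odd numbers below p are p minus the even ones, in reverse order. *)
Let DE : D = \prod_(0 <= i < K) (p%:R - 2 * i.+1%:R).
Proof.
rewrite /D big_nat_rev /=; apply: eq_big_nat => i /andP[_ iK].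
by rewrite -natrM -natrB; [congr (_%:R); lia|lia].
Qed.

Let pint_sub i j : (i%:R - j%:R : rat) \in pint p.
Proof. by rewrite rpredB ?rpred_nat. Qed.

(* With A = K!, E = (p-1)...(p-K) and D = (p-2)(p-4)...(p-2K), one has
   (p-1)! = A E = 2^K A D and D^2 = (-4)^K A E mod p^2; eliminating E
   yields D = (-8)^K A. *)
Lemma fact_double_pcongr :
  pcongr p (p ^ 2) ((2 * K)`!)%:R ((- 16) ^+ K * (K`!)%:R ^+ 2).
Proof.
have DD : pcongr p (p ^ 2) (D * D) ((- 4) ^+ K * ((2 * K)`!)%:R).
  have -> : (- 4) ^+ K * ((2 * K)`!)%:R
      = \prod_(0 <= i < K) (- 4 * (i.+1%:R * (p%:R - i.+1%:R))) :> rat.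
    rewrite factE /A natr_fact -big_split /= [RHS]big_split /=.
    by rewrite prodr_const_nat subn0.
  rewrite {1 2}DE -big_split /=; apply: pcongr_prod => i iK.
  split; try by apply/pintP; rewrite -?natrM ?rpredM ?rpredN ?rpred_nat.
  (* With j = i + 1: (p - 2j)^2 = -4 j (p - j) + p^2. *)
  exists 1; first exact/pintP/rpred1.
  by rewrite natrX; ring.
have f0 := fact_neq0 (2 * K).
(* D divides (2K)!, which is prime to p, so D may be cancelled. *)
have DV : D^-1 = 2 ^+ K * A / ((2 * K)`!)%:R.
  rewrite natr_fact_double -/A -/D invfM mulVKf //.
  by rewrite mulf_neq0 ?expf_neq0 ?fact_neq0.
have pDV : D^-1 \in pint p.
  by rewrite DV rpredM ?rpredM ?rpredX ?rpred_nat // pint_factV // pE.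
have D0 : D != 0.
  by apply: contra_neq f0; rewrite natr_fact_double -/D => ->; rewrite mulr0.
(* Dividing by D and then multiplying by 2^K A turns the left side into (2K)!. *)
have := pcongrM DD (pcongr_refl _ pDV); rewrite mulfK //.
move/(pcongrM (pcongr_refl (p ^ 2) (_ : 2 ^+ K * A \in pint p))).
rewrite -natr_fact_double natr_fact_double -/A -/D.
have -> : 2 ^+ K * A * ((-4) ^+ K * (2 ^+ K * A * D) / D)
    = (- 16) ^+ K * A ^+ 2.
  have -> : (- 16 : rat) = 2 * - 4 * 2 by [].
  by rewrite !exprMn; move: (2 ^+ K) ((- 4) ^+ K) => x y; field.
by apply; rewrite rpredM ?rpredX ?rpred_nat.
Qed.

Lemma prod_half_pcongr :
  pcongr p (p ^ 2) (\prod_(0 <= i < 2 * K) (p%:R / 2 + i.+1%:R))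
    ((- 16) ^+ K * (K`!)%:R ^+ 2).
Proof.
apply: pcongr_trans fact_double_pcongr; rewrite natr_fact !prod_nat_fold.
have ph : (p%:R / 2 : rat) \in pint p.
  by rewrite rpredM ?rpred_nat // pint_natV.
apply: pcongr_prod => i iK; rewrite natr_foldE //.
split; try by apply/pintP; rewrite rpredM ?rpredD ?rpredN ?rpred_nat.
(* With j = i + 1: (p/2 + j) (p/2 + p - j) = j (p - j) + 3 p^2 / 4. *)
exists (3 * (1 / 2 * (1 / 2))).
  by apply/pintP/rpredM; [exact: rpred_nat|exact: rpredM].
by rewrite natrX; field.
Qed.

(** * The diagonal term and the sum *)

Lemma WZF_diag : WZF K K
  = p%:R * (3 * ((\prod_(0 <= i < 2 * K) (p%:R / 2 + i.+1%:R))
                 * ((16 ^+ K)^-1 * (K`!)%:R^-1 ^+ 2))).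
Proof.
have h : (1 / 2 + K%:R : rat) = p%:R / 2.
  by rewrite pE -[(2 * K).+1%:R]natr1 natrM; field.
have e : (20 * K%:R - 2 * K%:R + 3) * poch (1 / 2 + K%:R) (2 * K)
    = 3 * p%:R * \prod_(0 <= i < 2 * K) (p%:R / 2 + i.+1%:R) :> rat.
  (* The linear factor supplies the missing last factor p/2 + 2K of the product, and 6 times the
     first factor p/2 gives 3p. *)
  have -> : 20 * K%:R - 2 * K%:R + 3 = 6 * (p%:R / 2 + (2 * K)%:R) :> rat.
    by rewrite pE -[(2 * K).+1%:R]natr1 !natrM; field.
  rewrite h mulrAC -[6 * _ * _]mulrA -pochS /poch big_nat_recl //.
  by rewrite addr0; field.
have -> : WZF K K = (20 * K%:R - 2 * K%:R + 3) * poch (1 / 2 + K%:R) (2 * K)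
    / (16 ^+ K * (K`!)%:R ^+ 2).
  have p0 : poch (1 / 2) K != 0 by rewrite gt_eqF ?poch_gt0.
  have f0 := fact_neq0 K.
  have e0 : (16 ^+ K : rat) != 0 by rewrite expf_neq0.
  rewrite /WZF addnn -mul2n exprM sqrrN !expr1n.
  (* Splitting (1/2)_(3K) yields a second (1/2)_K, which cancels the squared denominator. *)
  rewrite [(2 * K + K)%N]addnC pochD /rfact leqnn subnn fact0.
  move: (poch _ K) (poch _ (2 * K)) (16 ^+ K) p0 e0 => a b c a0 c0.
  by field; rewrite a0 f0 c0.
have f0 := fact_neq0 K.
have e0 : (16 ^+ K : rat) != 0 by rewrite expf_neq0.
by rewrite e; move: (16 ^+ K) e0 => x x0; field; rewrite x0 f0.
Qed.

Lemma WZF_diag_pcongr : pcongr p (p ^ 3) (WZF K K) (3 * (-1) ^+ K * p%:R).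
Proof.
rewrite WZF_diag [3 * _ * _]mulrC expnS; apply: pcongr_scale.
apply: pcongrM; first exact/pcongr_refl/rpred_nat.
have f0 := fact_neq0 K.
have e0 : (16 ^+ K : rat) != 0 by rewrite expf_neq0.
have -> : (-1) ^+ K = (- 16) ^+ K * (K`!)%:R ^+ 2
    * ((16 ^+ K)^-1 * (K`!)%:R^-1 ^+ 2) :> rat.
  rewrite -[- 16]mulN1r exprMn exprVn.
  by move: (16 ^+ K) e0 => x x0; field; rewrite x0 f0.
apply: pcongrM; first exact: prod_half_pcongr.
by apply: pcongr_refl; rewrite rpredM ?rpredX // pint_factV //; lia.
Qed.

Lemma WZF_sum_pcongr :
  pcongr p (p ^ 3) (\sum_(0 <= n < p) WZF n 0) (3 * (-1) ^+ K * p%:R).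
Proof.
rewrite (WZ_sum _ K) -[3 * _ * _]addr0; apply: pcongrD; last first.
  by apply: pcongr0_sum => k /andP[_]; exact: pcongr0_WZG.
rewrite (big_cat_nat _ (n := K)) //=; last by lia.
(* For n < K the factor [rfact n K] is 0. *)
rewrite big_nat_cond big1 ?add0r; last first.
  move=> n /andP[/andP[_ nK] _].
  by rewrite /WZF /rfact leqNgt nK mulr0 mul0r.
rewrite big_ltn; last by lia.
rewrite -[3 * _ * _]addr0; apply: pcongrD; first exact: WZF_diag_pcongr.
by apply: pcongr0_sum => n; exact: pcongr0_WZF.
Qed.

End OddPrime.

Theorem theorem3 (p : nat) (p_prime : prime p) (p_gt2 : (2 < p)%N) :
  pcongr p (p ^ 3)%N
    (\sum_(0 <= n < p)
       poch (1 / 2) n * poch (1 / 2) (2 * n)%N / (n`!)%:R ^+ 3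
       * (20 * n%:R + 3) * ((-1) ^+ n / 2 ^+ (4 * n)%N))
    (3 * (-1) ^+ ((p - 1) %/ 2)%N * p%:R)
  /\
  pcongr p (p ^ 3)%N
    (\sum_(0 <= n < p)
       poch (1 / 2) n * poch (1 / 4) n * poch (3 / 4) n / (n`!)%:R ^+ 3
       * (20 * n%:R + 3) * ((-1) ^+ n / 2 ^+ (2 * n)%N))
    (3 * (-1) ^+ ((p - 1) %/ 2)%N * p%:R).
Proof.
have pE : p = (2 * ((p - 1) %/ 2)).+1.
  have := even_prime p_prime; lia.
have := WZF_sum_pcongr p_prime pE.
have FE n : WZF n 0 = poch (1 / 2) n * poch (1 / 2) (2 * n)%N / (n`!)%:R ^+ 3
    * (20 * n%:R + 3) * ((-1) ^+ n / 2 ^+ (4 * n)%N).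
  have f0 := fact_neq0 n.
  have e0 : (16 ^+ n : rat) != 0 by rewrite expf_neq0.
  rewrite /WZF !addn0 /rfact leq0n subn0 exprM [poch _ 0]big_geq // mulr0 subr0.
  have -> : (2 ^+ 4 : rat) = 16 by [].
  by move: (16 ^+ n) e0 => x x0; field; rewrite f0 x0.
under eq_bigr do rewrite FE.
move=> main; split=> //; congr pcongr: main.
(* The two sums agree termwise: the 4^n produced here reduces 2^(4n) to 2^(2n). *)
apply: eq_bigr => n _; rewrite poch_half_double.
have f0 := fact_neq0 n.
have e0 : (4 ^+ n : rat) != 0 by rewrite expf_neq0.
have -> : (2 ^+ (4 * n) : rat) = 4 ^+ n * 4 ^+ n.
  by rewrite -exprMn exprM; congr (_ ^+ _).
have -> : (2 ^+ (2 * n) : rat) = 4 ^+ n by rewrite exprM; congr (_ ^+ _).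
by move: (4 ^+ n) e0 => x x0; field; rewrite f0 x0.
Qed.
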